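(* Let $h:\mathbb{R}\to\mathbb{R}$ and $\varphi:(0,\infty)\to(0,\infty)$, and let $$H^*(x):=\limsup_{t\to\infty}\,[h(t+x\varphi(t))-h(t)]$$ (with values in the extended real line). (i) If $h$ and $\varphi$ are Borel (have Borel graph), then the graph of the function $H^*$ is a difference of two analytic sets, hence is measurable and $\mathbf{\Delta}^1_2$. If the graphs of $h$ and $\varphi$ are $\mathcal{F}_\sigma$, then the graph of $H^*$ is Borel. (ii) If $h$ and $\varphi$ are analytic (have analytic graph), then the graph of $H^*$ is $\mathbf{\Pi}^1_2$. (iii) If $h$ and $\varphi$ are co-analytic (have co-analytic graph), then the graph of $H^*$ is $\mathbf{\Pi}^1_3$.
   Context: The classes are those of the (boldface) projective hierarchy in Euclidean space: $\mathbf{\Sigma}^1_1$ denotes the analytic sets, $\mathbf{\Pi}^1_1$ their complements (co-analytic sets), $\mathbf{\Sigma}^1_{n+1}$ the projections of $\mathbf{\Pi}^1_n$ sets, $\mathbf{\Pi}^1_{n+1}$ the complements of $\mathbf{\Sigma}^1_{n+1}$ sets, and $\mathbf{\Delta}^1_n:=\mathbf{\Sigma}^1_n\cap\mathbf{\Pi}^1_n$. Functions are identified with their graphs. *)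

(* Defs.v *)
From HB Require Import structures.
From mathcomp Require Import all_boot all_order all_algebra.
From mathcomp Require Import all_classical all_reals all_analysis measurable_realfun.

Set Implicit Arguments.
Unset Strict Implicit.
Unset Printing Implicit Defensive.

Import Order.TTheory GRing.Theory Num.Theory.
Import numFieldNormedType.Exports.

Local Open Scope classical_set_scope.
Local Open Scope ring_scope.

Definition graph_on {T U : Type} (D : set T) (f : T -> U) : set (T * U) :=
  [set p | D p.1 /\ p.2 = f p.1].

(* The topological Borel sets, independently of any measurable structure that
   X may carry. *)
Definition borel {X : topologicalType} (A : set X) : Prop := <<s @open X >> A.

Section projective_hierarchy.
Variable R : realType.

(* The ambient space X varies because projections are taken along a real
   coordinate: when X is R^k, X * R is R^(k+1).  X = R * \bar R is also needed,
   for graphs of extended-real-valued functions, so X is left arbitrary. *)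
Definition analytic {X : topologicalType} (A : set X) : Prop :=
  exists2 B : set (X * R), borel B & A = fst @` B.

(* Sigma1 n is boldface Sigma^1_n for n >= 1.  Level 0 is not part of the
   hierarchy; it is given the value borel. *)
Fixpoint Sigma1 (n : nat) {X : topologicalType} (A : set X) {struct n} : Prop :=
  match n with
  | 0 => borel A
  | 1 => analytic A
  | m.+1 => exists2 B : set (X * R), Sigma1 m (~` B) & A = fst @` B
  end.

Definition Pi1 (n : nat) {X : topologicalType} (A : set X) : Prop :=
  Sigma1 n (~` A).

Definition Delta1 (n : nat) {X : topologicalType} (A : set X) : Prop :=
  Sigma1 n A /\ Pi1 n A.

Definition coanalytic {X : topologicalType} (A : set X) : Prop :=
  analytic (~` A).

End projective_hierarchy.

(* Lebesgue measurability in R x [-oo, +oo]: the trace on the plane R x R is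
   Lebesgue measurable for planar measure, and so are, for linear measure, the
   traces on the two lines at infinity.  For a measure mu,
   completed_algebra_gen mu is the completed sigma-algebra itself: the sets
   A `|` N with A measurable and N negligible. *)
Definition lebesgue_measurable_ext {R : realType} (E : set (R * \bar R)) : Prop :=
  [/\ completed_algebra_gen
        (@lebesgue_measure R \x @lebesgue_measure R)%E
        [set p : measurableTypeR R * measurableTypeR R | E (p.1, p.2%:E)],
      completed_algebra_gen (@lebesgue_measure R) [set x | E (x, +oo%E)] &
      completed_algebra_gen (@lebesgue_measure R) [set x | E (x, -oo%E)]].

Definition Hstar {R : realType} (h phi : R -> R) (x : R) : \bar R :=
  limf_esup (fun t : R => (h (t + x * phi t) - h t)%:E) (pinfty_nbhs R).

(* Main.v *)
Require Import Defs.
From mathcomp Require Import all_boot all_order all_algebra.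
From mathcomp Require Import all_classical all_reals all_analysis.
From mathcomp Require Import borel_hierarchy measurable_realfun zify lra.

(** Why the classification holds.

    Write F(t, x) = h(t + x phi(t)) - h(t), and say that c is frequently
    exceeded at x when F(t, x) > c for arbitrarily large t.  Every q < H*(x) is
    frequently exceeded at x, and every frequently exceeded q satisfies
    q <= H*(x).  Letting q run through the rationals, y <= H*(x) means that all
    q < y are frequently exceeded at x, and y < H*(x) that some q > y is.  So
    both relations come from the sets [set x | exists2 t, t > n & F(t, x) > q]
    by countable operations, and the graph of H* is the difference of the two.

    To say F(t, x) > q through graphs, quantify existentially u, v, w with
    (t, u) in the graph of phi and (t + x u, v), (t, w) in the graph of h; with
    t, this makes four projections along a real coordinate.  A class that is
    closed under continuous preimages, intersections and projections along R,
    and contains the sets 0 < f for f continuous, therefore contains these sets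
    as soon as it contains the two graphs (projective_class_exceeds).  This
    covers analytic sets, Sigma^1_2 sets (for co-analytic graphs) and F_sigma
    sets (as R is sigma-compact), and the countable operations keep the first
    two classes and lead from F_sigma sets to Borel ones.  A difference of
    analytic sets and its complement are Sigma^1_2; the complement of a
    difference of Sigma^1_2 sets is Sigma^1_3.

    The closure properties rest on coding a sequence of reals by one real
    (real_code_onto, borel_real_code): with Borel decoding maps, a countable
    intersection of projections is one projection, and so are two successive
    projections (sigma_pointclass_proj, proj_proj).

    Measurability of the graph needs analytic sets to be measurable for every
    sigma-finite measure.  An analytic set is the result of the Suslin operation
    on Borel sets (analytic_suslin): it has the form of a union, over sequences
    a of integers, of intersections of sets D n a each depending on finitely
    many terms of a.  For a finite measure one bounds the terms of a one by one,
    keeping the outer measure above any given c below that of the whole set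
    (continuity from below), and obtains bounds N.  With a <= N the tree of
    codes is finitely branching, so by Koenig's lemma the intersection of the
    measurable sets obtained from the first k conditions lies in the set, and
    continuity from above shows that its measure is at least c
    (suslin_inner_approx). *)

Import Order.TTheory GRing.Theory Num.Theory.
Import numFieldNormedType.Exports.

Set Implicit Arguments.
Unset Strict Implicit.
Unset Printing Implicit Defensive.

Local Open Scope classical_set_scope.
Local Open Scope ring_scope.

(** * Logical operations in a sigma-algebra *)

Section sigma_algebra_logic.
Context {T : Type} {M : set (set T)}.
Hypothesis sM : sigma_algebra setT M.

Lemma sigmaN (P : T -> Prop) : M [set x | P x] -> M [set x | ~ P x].
Proof. by case: sM => _ MC _ /MC; rewrite setTD. Qed.

Lemma sigma_ex (I : countType) (P : I -> T -> Prop) :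
  (forall i, M [set x | P i x]) -> M [set x | exists i, P i x].
Proof.
case: sM => M0 _ Mcup MP.
pose F n : set T := if unpickle n is Some i then [set x | P i x] else set0.
rewrite (_ : [set x | _] = \bigcup_n F n).
  by apply: Mcup => n; rewrite /F; case: unpickle.
apply/seteqP; split=> [x [i Px]|x [n _]] /=.
  by exists (pickle i) => //; rewrite /F pickleK.
by rewrite /F; case: unpickle => // i Px; exists i.
Qed.

Lemma sigma_all (I : countType) (P : I -> T -> Prop) :
  (forall i, M [set x | P i x]) -> M [set x | forall i, P i x].
Proof.
move=> MP; rewrite (_ : [set x | _] = [set x | ~ exists i, ~ P i x]).
  by apply/sigmaN/sigma_ex => i; exact: sigmaN.
apply/seteqP; split=> x /= => [Px [i nPx]|/forallNP Px i].
  exact/nPx.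
exact: contrapT.
Qed.

Lemma sigma_cst (P : Prop) : M [set x | P].
Proof.
have [M0 _ _] := sM; have [p|np] := pselect P.
  rewrite (_ : [set x | P] = [set x | ~ set0 x]); first exact: sigmaN.
  by apply/seteqP; split=> x //= _ [].
by rewrite (_ : [set x | P] = set0)//; apply/seteqP; split=> [x|x []].
Qed.

Lemma sigma_and (P Q : T -> Prop) :
  M [set x | P x] -> M [set x | Q x] -> M [set x | P x /\ Q x].
Proof.
move=> MP MQ; rewrite (_ : [set x | _] =
    [set x | forall b : bool, if b then P x else Q x]).
  by apply: sigma_all => -[].
by apply/seteqP; split=> x /= => [[? ?] []|PQ] //; split;
  [exact: (PQ true)|exact: (PQ false)].
Qed.

Lemma sigma_or (P Q : T -> Prop) :
  M [set x | P x] -> M [set x | Q x] -> M [set x | P x \/ Q x].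
Proof.
move=> MP MQ; rewrite (_ : [set x | _] =
    [set x | exists b : bool, if b then P x else Q x]).
  by apply: sigma_ex => -[].
by apply/seteqP; split=> x /= => [[?|?]|[[] ?]];
  [exists true|exists false|left|right].
Qed.

Lemma sigma_imply (P Q : T -> Prop) :
  M [set x | P x] -> M [set x | Q x] -> M [set x | P x -> Q x].
Proof.
move=> MP MQ; rewrite (_ : [set x | _] = [set x | ~ P x \/ Q x]).
  by apply: sigma_or => //; exact: sigmaN.
apply/seteqP; split=> x /= => [PQ|[nPx Px|Qx _]] //.
by have [/PQ|] := pselect (P x); [right|left].
Qed.

End sigma_algebra_logic.

(** * Borel sets *)

Lemma sigma_algebra_borel (X : topologicalType) : sigma_algebra setT (@borel X).
Proof. exact: smallest_sigma_algebra. Qed.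

Lemma open_borel (X : topologicalType) (A : set X) : open A -> borel A.
Proof. by move=> oA; exact: sub_sigma_algebra. Qed.

Lemma closed_borel (X : topologicalType) (A : set X) : closed A -> borel A.
Proof.
move=> cA; rewrite -(setCK A); apply: (sigmaN (sigma_algebra_borel X)).
by apply: open_borel; exact: closed_openC.
Qed.

Lemma borel_preimage_sigma (Z : Type) (M : set (set Z)) (X : topologicalType)
    (f : Z -> X) : sigma_algebra setT M ->
  (forall U, open U -> M (f @^-1` U)) ->
  forall B, borel B -> M (f @^-1` B).
Proof.
move=> sM fo; apply: smallest_sub => //; split=> [|A MA|F MF].
- exact: (sigma_cst sM False).
- by rewrite setTD; exact: (sigmaN sM).
- rewrite preimage_bigcup; have [_ _] := sM; exact.
Qed.

Section rational_rays.
Context {R : realType} {Z : Type} {M : set (set Z)}.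
Hypothesis sM : sigma_algebra setT M.

Lemma rat_between (x y : R) : x < y -> exists q : rat, x < ratr q < y.
Proof. by move=> /rat_in_itvoo[q]; rewrite in_itv /=; exists q. Qed.

Lemma sigma_rays (g : Z -> R) :
    (forall q : rat, M [set z | ratr q < g z]) ->
  forall p q : rat, M [set z | ratr p < g z < ratr q].
Proof.
move=> Mg p q.
rewrite (_ : [set z | _] = [set z | ratr p < g z /\
    exists r : rat, r < q /\ ~ (ratr r < g z)]).
  apply: (sigma_and sM) => //; apply: (sigma_ex sM) => r.
  by apply: (sigma_and sM); [exact: sigma_cst|exact: (sigmaN sM)].
apply/seteqP; split=> z /=.
  move=> /andP[-> /rat_between[r /andP[gr rq]]]; split=> //; exists r.
  by rewrite -(ltr_rat R); split=> //; apply/negP; rewrite -leNgt ltW.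
move=> [-> [r [rq /negP]]]; rewrite -leNgt => gr /=.
by rewrite (le_lt_trans gr)// ltr_rat.
Qed.
End rational_rays.

(** Since R has a countable base, an open subset of X * R is a countable union
    of open rectangles, whatever the space X.  So Borel measurability of a map
    into X * R can be tested coordinatewise even if X is not second
    countable. *)
Lemma borel_pair_sigma (R : realType) (Z : Type) (M : set (set Z))
    (X : topologicalType) (f : Z -> X) (g : Z -> R) :
    sigma_algebra setT M ->
    (forall U, open U -> M (f @^-1` U)) ->
    (forall q : rat, M [set z | ratr q < g z]) ->
  forall B, borel B -> M ((fun z => (f z, g z)) @^-1` B).
Proof.
move=> sM fo gr; apply: borel_preimage_sigma => // U oU.
rewrite (_ : _ @^-1` U = [set z | exists pq : rat * rat,
    ((fun x => forall y, ratr pq.1 < y < ratr pq.2 -> U (x, y))^° (f z)) /\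
    ratr pq.1 < g z < ratr pq.2]).
  apply: (sigma_ex sM) => -[p q]; apply: (sigma_and sM) => /=.
    exact/fo/open_interior.
  exact: sigma_rays.
apply/seteqP; split=> z /=; last first.
  by move=> [[p q] [/= /interior_subset + gz]] => /(_ _ gz).
move=> Uz; have : nbhs (f z, g z) U by exact: open_nbhs_nbhs.
move=> [[V W] /= [Vf Wg] VWU].
have [e /= e0 eW] := Wg.
have [p /andP[gp pg]] : exists p : rat, g z - e < ratr p < g z.
  by apply: rat_between; lra.
have [q /andP[gq qg]] : exists q : rat, g z < ratr q < g z + e.
  by apply: rat_between; lra.
exists (p, q) => /=; split; last by rewrite pg gq.
apply: filterS Vf => x Vx y /andP[py yq]; apply: (VWU (x, y)); split => //=.
by apply: eW; rewrite /ball_/= ltr_norml; apply/andP; split; lra.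
Qed.

(** * Coding countably many reals by one *)

(** The real defined by a lower cut.  On an empty or unbounded S it takes the
    default value 0 of sup, which makes it total on sets of rationals. *)
Definition cut_sup {R : realType} (S : set rat) : R :=
  sup [set ratr q | q in S].

Lemma cut_sup_lt (R : realType) (y : R) : cut_sup [set q | ratr q < y] = y.
Proof.
have [p /andP[_ py]] : exists p : rat, y - 1 < ratr p < y.
  by apply: rat_between; lra.
apply/eqP; rewrite eq_le; apply/andP; split.
  apply: ge_sup; first by exists (ratr p), p.
  by move=> _ [q /= /ltW qy <-].
rewrite leNgt; apply/negP => /rat_between[q /andP[sq qy]].
suff : ratr q <= cut_sup [set q0 | ratr q0 < y] :> R by rewrite leNgt sq.
apply: ub_le_sup; last by exists q.
by exists y => _ [r /= /ltW ry <-].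
Qed.

(** Whether the default value 0 is used is itself decided by countably many
    membership conditions, hence the case split on V. *)
Lemma cut_sup_sigma (R : realType) (Z : Type) (M : set (set Z))
    (S : Z -> set rat) : sigma_algebra setT M ->
    (forall q, M [set z | S z q]) ->
  forall p : rat, M [set z | ratr p < (cut_sup (S z) : R)].
Proof.
move=> sM MS p.
pose V z := (exists q, S z q) /\ (exists b : rat, forall q, S z q -> q <= b).
have MV : M [set z | V z].
  apply: (sigma_and sM); first exact: (sigma_ex sM).
  apply: (sigma_ex sM) => b; apply: (sigma_all sM) => q.
  by apply: (sigma_imply sM) => //; exact: sigma_cst.
have VP z : V z <-> has_sup [set (ratr q : R) | q in S z].
  split=> [[[q Sq] [b Sb]]|[[_ [q Sq _]] [b Sb]]]; split.
  - by exists (ratr q), q.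
  - by exists (ratr b) => _ [r /Sb rb <-]; rewrite ler_rat.
  - by exists q.
  - have [c /andP[bc _]] : exists c : rat, b < ratr c < b + 1.
      by apply: rat_between; lra.
    exists c => r Sr; rewrite -(ler_rat R) (le_trans _ (ltW bc))//.
    by apply: Sb; exists r.
rewrite (_ : [set z | _] = [set z | (V z /\ exists q, S z q /\ p < q) \/
    (~ V z /\ (ratr p < 0 :> R))]).
  apply: (sigma_or sM); apply: (sigma_and sM) => //.
  - apply: (sigma_ex sM) => q; apply: (sigma_and sM) => //; exact: sigma_cst.
  - exact: (sigmaN sM).
  - exact: sigma_cst.
apply/seteqP; split=> z /=.
  have [Vz|nVz] := pselect (V z).
    have [S0 _] := (VP z).1 Vz; move=> /(sup_gt S0)[_ [q Sq <-]].
    by rewrite ltr_rat => pq; left; split=> //; exists q.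
  by rewrite /cut_sup sup_out; [right|move/VP].
move=> [[/VP[_ ubS] [q [Sq pq]]]|[/VP/sup_out]]; last by rewrite /cut_sup => ->.
apply: (@lt_le_trans _ _ (ratr q)); first by rewrite ltr_rat.
by apply: ub_le_sup => //; exists q.
Qed.

Section digits.
Context {R : realType}.

(** Oddness of an integer part in base 4 serves as a bit: a base 4 expansion
    with digits 0 and 1 only is recovered from its value, because its tails are
    at most 1/3 of a unit; in base 2, tails of ones would cause ambiguity. *)
Definition digit (z : R) (i : nat) : Prop :=
  exists k : nat, (k.*2.+1)%:R <= z * 4 ^+ i.+1 < (k.*2.+2)%:R.

Lemma borel_digit i : borel [set z | digit z i].
Proof.
pose mul4 (z : R) := z * 4 ^+ i.+1.
have cmul : continuous mul4 by exact: mulrr_continuous.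
apply: (sigma_ex (sigma_algebra_borel R)) => k.
rewrite (_ : [set z | _] =
    mul4 @^-1` [set x | k.*2.+1%:R <= x] `&`
    mul4 @^-1` [set x | x < k.*2.+2%:R]).
  apply: (sigma_and (sigma_algebra_borel R)).
    apply: closed_borel; move/continuous_closedP : cmul; apply.
    exact: closed_ge.
  apply: open_borel; move/continuousP : cmul; apply.
  exact: open_lt.
by apply/seteqP; split=> z /= => [/andP[]|[? ?]] //; apply/andP.
Qed.

Lemma digit_onto (S : set nat) : exists z, forall i, digit z i <-> S i.
Proof.
(* n i is the integer whose base 4 digits are the first i + 1 terms of S *)
pose fix n (i : nat) : nat :=
  ((if i is j.+1 then 4 * n j else 0) + `[< S i >])%N.
have n_lo i k : (n i * 4 ^ k <= n (i + k))%N.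
  elim: k => [|k IH]; first by rewrite addn0 expn0 muln1.
  have nS : n (i + k.+1)%N = (4 * n (i + k) + `[< S (i + k).+1 >])%N.
    by rewrite addnS.
  by rewrite expnS nS; move: (nat_of_bool _) IH => b; nia.
have n_hi i k : (3 * n (i + k) + 1 <= (3 * n i + 1) * 4 ^ k)%N.
  elim: k => [|k IH]; first by rewrite addn0 expn0 muln1.
  have nS : n (i + k.+1)%N = (4 * n (i + k) + `[< S (i + k).+1 >])%N.
    by rewrite addnS.
  have := leq_b1 `[< S (i + k).+1 >]; rewrite expnS nS.
  by move: (nat_of_bool _) IH => b; nia.
have n_cross i j : (3 * (n j * 4 ^ i.+1) <= (3 * n i + 1) * 4 ^ j.+1)%N.
  have [/subnKC<-|/ltnW/subnKC<-] := leqP i j; rewrite -addSn expnD.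
    move: (n_hi i (j - i)%N); move: (4 ^ i.+1)%N (4 ^ _)%N => P Q.
    by move=> /(leq_mul (leqnn P)); nia.
  move: (n_lo j (i - j)%N); move: (4 ^ j.+1)%N (4 ^ _)%N => P Q.
  by move=> /(leq_mul (leqnn P)); nia.
pose E : set R := [set (n j)%:R / 4 ^+ j.+1 | j in setT].
have E_ub i : ubound E (((n i)%:R + 3^-1) / 4 ^+ i.+1).
  move=> _ [j _ <-]; rewrite ler_pdivrMr ?exprn_gt0// mulrAC.
  rewrite ler_pdivlMr ?exprn_gt0//.
  have := n_cross i j; rewrite -(ler_nat R) !natrM natrD natrM !natrX.
  by lra.
(* n i is the integer part of sup E * 4 ^ (i + 1), and the rest at most 1/3 *)
have z_lo i : (n i)%:R <= sup E * 4 ^+ i.+1.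
  rewrite -ler_pdivrMr ?exprn_gt0//; apply: ub_le_sup; last by exists i.
  by exists (((n 0)%:R + 3^-1) / 4 ^+ 1); exact: E_ub.
have z_hi i : sup E * 4 ^+ i.+1 <= (n i)%:R + 3^-1.
  rewrite -ler_pdivlMr ?exprn_gt0//; apply: ge_sup; last exact: E_ub.
  by exists ((n 0)%:R / 4 ^+ 1), 0%N.
have n_third m : m%:R + 3^-1 < m.+1%:R :> R.
  by rewrite -(natr1 m) ltrD2l invf_lt1 ?ltr1n.
have odd_n i : odd (n i) = `[< S i >].
  by case: i => [|i] /=; rewrite oddD ?oddM /= oddb.
exists (sup E) => i; split=> [[k /andP[lo hi]]|Si].
  apply/asboolP; rewrite -odd_n.
  have lo' : (k.*2.+1 < (n i).+1)%N.
    by rewrite -(ltr_nat R) (le_lt_trans lo)// (le_lt_trans (z_hi i))// n_third.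
  have hi' : (n i < k.*2.+2)%N by rewrite -(ltr_nat R) (le_lt_trans (z_lo i)).
  have -> : n i = k.*2.+1 by apply/eqP; rewrite eqn_leq; exact/andP.
  by rewrite oddS odd_double.
have on : odd (n i) by rewrite odd_n; exact/asboolP.
have {}on : (n i)./2.*2.+1 = n i by rewrite -[RHS]odd_double_half on.
exists (n i)./2; rewrite on; apply/andP; split=> //.
by rewrite (le_lt_trans (z_hi i))// n_third.
Qed.

(** The k-th real coded by z: bit <k, q> of z tells whether q lies below it. *)
Definition real_code (k : nat) (z : R) : R :=
  cut_sup [set q | digit z (pickle (k, q))].

Lemma real_code_onto (y : nat -> R) : exists z, forall k, real_code k z = y k.
Proof.
have [z zP] := digit_onto
  [set i | exists k q, i = pickle (k, q) /\ ratr q < y k].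
exists z => k; rewrite -[RHS]cut_sup_lt; congr cut_sup.
apply/seteqP; split=> q /=.
  by move=> /zP[k' [q' [/(pcan_inj pickleK)[-> ->]]]].
by move=> qy; apply/zP; exists k, q.
Qed.

Lemma borel_real_code k (q : rat) : borel [set z | ratr q < real_code k z].
Proof.
by apply: (cut_sup_sigma R (sigma_algebra_borel R) (S :=
  fun z => [set r : rat | digit z (pickle (k, r))])) => p; exact: borel_digit.
Qed.

End digits.

(** * Borel maps *)

Definition borel_map {X Y : topologicalType} (f : X -> Y) : Prop :=
  forall B, borel B -> borel (f @^-1` B).

Lemma continuous_borel_map (X Y : topologicalType) (f : X -> Y) :
  continuous f -> borel_map f.
Proof.
move=> cf; apply: borel_preimage_sigma; first exact: sigma_algebra_borel.
by move=> U oU; apply: open_borel; move/continuousP : cf; apply.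
Qed.

Lemma borel_map_pair (R : realType) (Z X : topologicalType)
    (f : Z -> X) (g : Z -> R) :
  borel_map f -> (forall q : rat, borel [set z | ratr q < g z]) ->
  borel_map (fun z => (f z, g z)).
Proof.
move=> bf bg; apply: borel_pair_sigma => //; first exact: sigma_algebra_borel.
by move=> U /open_borel; exact: bf.
Qed.

Lemma fst_continuous (X Y : topologicalType) : continuous (@fst X Y).
Proof. move=> [x y]; exact: (@cvg_fst _ _ (nbhs x) (nbhs y)). Qed.

Lemma snd_continuous (X Y : topologicalType) : continuous (@snd X Y).
Proof. move=> [x y]; exact: (@cvg_snd _ _ (nbhs x) (nbhs y)). Qed.

Lemma borel_map_fst (X Y : topologicalType) : borel_map (@fst X Y).
Proof. by apply: continuous_borel_map; exact: fst_continuous. Qed.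

Lemma borel_map_decode (R : realType) (X : topologicalType) k :
  borel_map (fun p : X * R => (p.1, real_code k p.2)).
Proof.
apply: borel_map_pair; first exact: borel_map_fst.
move=> q.
exact: (continuous_borel_map (@snd_continuous X R) (borel_real_code k q)).
Qed.

(** * Pointclasses *)

(** A pointclass has to be defined on all spaces at once, since projections
    change the ambient space. *)
Definition pointclass := forall X : topologicalType, set X -> Prop.

Definition dual (G : pointclass) : pointclass := fun X A => G X (~` A).

Definition real_proj (R : realType) (G : pointclass) : pointclass :=
  fun X A => exists2 B : set (X * R), G (X * R)%type B & A = fst @` B.

Record sigma_pointclass (G : pointclass) : Prop := {
  pc_preimage : forall (X Y : topologicalType) (f : X -> Y) B,
    borel_map f -> G Y B -> G X (f @^-1` B) ;
  pc_cap : forall (X : topologicalType) (A : nat -> set X),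
    (forall n, G X (A n)) -> G X (\bigcap_n A n) ;
  pc_cup : forall (X : topologicalType) (A : nat -> set X),
    (forall n, G X (A n)) -> G X (\bigcup_n A n) ;
  pc_borel : forall (X : topologicalType) (A : set X), borel A -> G X A }.

Lemma sigma_pointclass_borel : sigma_pointclass (@borel).
Proof.
split=> // [X Y f B|X A bA|X A bA]; first exact.
  rewrite (_ : \bigcap_n A n = [set x | forall n, A n x]).
    exact: (sigma_all (sigma_algebra_borel X)).
  by apply/seteqP; split=> x Ax n; [exact: Ax|move=> _; exact: Ax].
by have [_ _] := sigma_algebra_borel X; apply.
Qed.

Lemma sigma_pointclass_dual G : sigma_pointclass G -> sigma_pointclass (dual G).
Proof.
move=> gG; split; rewrite /dual.
- by move=> X Y f B bf GB; rewrite preimage_setC; exact: (pc_preimage gG).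
- by move=> X A GA; rewrite setC_bigcap; exact: (pc_cup gG).
- by move=> X A GA; rewrite setC_bigcup; exact: (pc_cap gG).
- move=> X A bA; apply: (pc_borel gG).
  exact: (sigmaN (sigma_algebra_borel X)).
Qed.

Lemma sub_proj (R : realType) G : sigma_pointclass G ->
  forall (X : topologicalType) (A : set X), G X A -> real_proj R G A.
Proof.
move=> gG X A GA; exists (fst @^-1` A).
  by apply: (pc_preimage gG) GA; exact: borel_map_fst.
by apply/seteqP; split=> [x Ax|_ [[x y] /= Ax <-]//]; exists (x, 0).
Qed.

(** Countable intersections are the point: the existential witnesses for the
    members of the sequence are independent of each other, and one real codes
    them all. *)
Lemma sigma_pointclass_proj (R : realType) G :
  sigma_pointclass G -> sigma_pointclass (real_proj R G).
Proof.
move=> gG; split.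
- move=> X Y f _ bf [B GB ->]; exists ((fun p => (f p.1, p.2)) @^-1` B).
    apply: (pc_preimage gG) GB; apply: borel_map_pair.
      by move=> C /bf; exact: borel_map_fst.
    move=> q.
    have := open_borel (@open_gt R (ratr q)).
    exact: (continuous_borel_map (@snd_continuous X R)).
  apply/seteqP; split=> x /=.
    by move=> [[y z] /= Byz yfx]; exists (x, z) => //=; rewrite -yfx.
  by move=> [[x' z] /= Bz <-]; exists (f x', z).
- move=> X A /(_ _)/cid2-/all_sig2[B GB AB].
  (* the witnesses y n for all the A n are packed into a single real *)
  exists (\bigcap_n (fun p => (p.1, real_code n p.2)) @^-1` B n).
    by apply: (pc_cap gG) => n; apply: (pc_preimage gG) (GB n);
      exact: borel_map_decode.
  apply/seteqP; split=> x /=.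
    move=> Ax; have /(_ _)/cid-/all_sig[y By] n : exists y, B n (x, y).
      by have := Ax n I; rewrite AB => -[[x' y] /= ? <-]; exists y.
    have [z zy] := real_code_onto y.
    by exists (x, z) => // n _ /=; rewrite zy.
  move=> [[x' z] /= Bz <-] n _; rewrite AB.
  by exists (x', real_code n z) => //; exact: Bz.
- move=> X A /(_ _)/cid2-/all_sig2[B GB AB].
  exists (\bigcup_n B n); first exact: (pc_cup gG).
  apply/seteqP; split=> x /=.
    by move=> [n _]; rewrite AB => -[p Bp <-]; exists p => //; exists n.
  by move=> [p [n _ Bp] <-]; exists n => //; rewrite AB; exists p.
- by move=> X A bA; apply: sub_proj => //; exact: (pc_borel gG).
Qed.

(** One real codes both quantified reals. *)
Lemma proj_proj (R : realType) G : sigma_pointclass G ->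
  forall (X : topologicalType) (A : set X),
  real_proj R (real_proj R G) A -> real_proj R G A.
Proof.
move=> gG X _ [_ [B GB ->] ->].
exists ((fun p : X * R => ((p.1, real_code 0 p.2), real_code 1 p.2)) @^-1` B).
  apply: (pc_preimage gG) GB; apply: borel_map_pair.
    exact: borel_map_decode.
  move=> q.
  exact: (continuous_borel_map (@snd_continuous X R) (borel_real_code 1 q)).
apply/seteqP; split=> [_ [_ [[[x y] z] /= Bxyz <-] <-]|_ [[x z] /= Bxz <-]].
  have [c cP] := real_code_onto (fun k => if k is 0 then y else z).
  by exists (x, c) => //=; rewrite !cP.
by exists (x, real_code 0 z) => //; exists (x, real_code 0 z, real_code 1 z).
Qed.

Section sigma_pointclass_logic.
Context {G : pointclass} {X : topologicalType}.
Hypothesis gG : sigma_pointclass G.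

Lemma pc_ex (I : countType) (P : I -> X -> Prop) :
  (forall i, @G X [set x | P i x]) -> @G X [set x | exists i, P i x].
Proof.
move=> GP.
pose F n : set X := if unpickle n is Some i then [set x | P i x] else set0.
rewrite (_ : [set x | _] = \bigcup_n F n).
  apply: (pc_cup gG) => n; rewrite /F; case: unpickle => //.
  apply: (pc_borel gG); exact: (sigma_cst (sigma_algebra_borel X) False).
apply/seteqP; split=> [x [i Px]|x [n _]] /=.
  by exists (pickle i) => //; rewrite /F pickleK.
by rewrite /F; case: unpickle => // i Px; exists i.
Qed.

Lemma pc_all (I : countType) (P : I -> X -> Prop) :
  (forall i, @G X [set x | P i x]) -> @G X [set x | forall i, P i x].
Proof.
move=> GP.
pose F n : set X := if unpickle n is Some i then [set x | P i x] else setT.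
rewrite (_ : [set x | _] = \bigcap_n F n).
  apply: (pc_cap gG) => n; rewrite /F; case: unpickle => //.
  apply: (pc_borel gG); exact: (sigma_cst (sigma_algebra_borel X) True).
apply/seteqP; split=> [x Px n _|x FP i] /=.
  by rewrite /F; case: unpickle => // i; exact: Px.
by have := FP (pickle i) Logic.I; rewrite /F pickleK.
Qed.

Lemma pc_setI (A B : set X) : @G X A -> @G X B -> @G X (A `&` B).
Proof.
move=> GA GB; rewrite (_ : A `&` B =
    [set x | forall b : bool, if b then A x else B x]).
  by apply: pc_all => -[].
by apply/seteqP; split=> x /= => [[Ax Bx] []|AB] //; split;
  [exact: (AB true)|exact: (AB false)].
Qed.

Lemma pc_setU (A B : set X) : @G X A -> @G X B -> @G X (A `|` B).
Proof.
move=> GA GB; rewrite (_ : A `|` B =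
    [set x | exists b : bool, if b then A x else B x]).
  by apply: pc_ex => -[].
by apply/seteqP; split=> x /= => [[?|?]|[[] ?]];
  [exists true|exists false|left|right].
Qed.

End sigma_pointclass_logic.

(** * The first levels of the projective hierarchy *)
Section levels.
Context {R : realType}.

Lemma sigma_pointclass_analytic : sigma_pointclass (@analytic R).
Proof. exact: (sigma_pointclass_proj R sigma_pointclass_borel). Qed.

Lemma sigma_pointclass_coanalytic : sigma_pointclass (@coanalytic R).
Proof. exact: (sigma_pointclass_dual sigma_pointclass_analytic). Qed.

Lemma sigma_pointclass_Sigma12 : sigma_pointclass (@Sigma1 R 2).
Proof. exact: (sigma_pointclass_proj R sigma_pointclass_coanalytic). Qed.

Lemma sigma_pointclass_Sigma13 : sigma_pointclass (@Sigma1 R 3).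
Proof.
have sP := sigma_pointclass_dual sigma_pointclass_Sigma12.
exact: (sigma_pointclass_proj R sP).
Qed.

Lemma analytic_Sigma12 (X : topologicalType) (A : set X) :
  analytic R A -> Sigma1 R 2 A.
Proof.
move=> [B bB ->]; exists B => //; exact: (pc_borel sigma_pointclass_coanalytic).
Qed.

Lemma coanalytic_Sigma12 (X : topologicalType) (A : set X) :
  coanalytic R A -> Sigma1 R 2 A.
Proof. by move=> cA; exact: (sub_proj R sigma_pointclass_coanalytic cA). Qed.

Lemma Sigma12_Sigma13 (X : topologicalType) (A : set X) :
  Sigma1 R 2 A -> Sigma1 R 3 A.
Proof.
by move=> [B cB ->]; exists B => //; exact: analytic_Sigma12.
Qed.

Lemma Pi12_Sigma13 (X : topologicalType) (A : set X) :
  Pi1 R 2 A -> Sigma1 R 3 A.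
Proof.
move=> pA.
exact: (sub_proj R (sigma_pointclass_dual sigma_pointclass_Sigma12) pA).
Qed.

End levels.

(** * Projecting the graph conditions *)

(** The closure properties that turn membership of the graphs of h and phi into
    membership of a set defined from them by real quantifiers.  Only sets of
    the form 0 < f are required of the open sets: in an arbitrary space an open
    set need not be F_sigma. *)
Record projective_class (R : realType) (G : pointclass) : Prop := {
  pj_preimage : forall (X Y : topologicalType) (f : X -> Y) B,
    continuous f -> G Y B -> G X (f @^-1` B) ;
  pj_setI : forall (X : topologicalType) (A B : set X),
    G X A -> G X B -> G X (A `&` B) ;
  pj_pos : forall (X : topologicalType) (f : X -> R),
    continuous f -> G X [set x | 0 < f x] ;
  pj_proj : forall (X : topologicalType) (B : set (X * R)),
    G (X * R)%type B -> G X (fst @` B) }.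

Lemma open_pos (R : realType) (X : topologicalType) (f : X -> R) :
  continuous f -> open [set x | 0 < f x].
Proof. by move=> /continuousP cf; exact: (cf _ (@open_gt R 0)). Qed.

Lemma projective_class_proj (R : realType) G :
  sigma_pointclass G -> projective_class R (real_proj R G).
Proof.
move=> gG; have pG := sigma_pointclass_proj R gG; split.
- move=> X Y f B /continuous_borel_map; exact: (pc_preimage pG).
- by move=> X A B; exact: (pc_setI pG).
- by move=> X f cf; apply: (pc_borel pG); apply: open_borel; exact: open_pos.
- by move=> X B GB; apply: proj_proj => //; exists B.
Qed.

Section Fsigma.

Lemma Fsigma_ex (X : topologicalType) (I : countType) (P : I -> X -> Prop) :
  (forall i, closed [set x | P i x]) -> Fsigma [set x | exists i, P i x].
Proof.
move=> cP.
exists (fun n => if unpickle n is Some i then [set x | P i x] else set0).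
  by move=> n; case: unpickle => // ; exact: closed0.
apply/seteqP; split=> [x [i Px]|x [n _]] /=.
  by exists (pickle i) => //=; rewrite pickleK.
by case: unpickle => // i Px; exists i.
Qed.

(** Tube lemma: the complement is open because [-r, r] is compact. *)
Lemma closed_proj_bounded (R : realType) (X : topologicalType) (r : R)
    (C : set (X * R)) : closed C ->
  closed [set x | exists2 y, `|y| <= r & C (x, y)].
Proof.
move=> cC; rewrite -openC openE => x nCx.
have cpt : compact `[- r, r]%classic by exact: segment_compact.
have /compact_near_coveringP := cpt.
move=> /(_ _ (nbhs x) (fun z y => ~ C (z, y)) _) near_cov.
have : \forall z \near x, `[- r, r]%classic `<=` (fun y => ~ C (z, y)).
  apply: near_cov => y; rewrite /= in_itv /= => yr.
  have : nbhs (x, y) (~` C).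
    apply: open_nbhs_nbhs; split; first exact: closed_openC.
    by move=> Cxy; apply: nCx; exists y => //; rewrite ler_norml.
  move=> [[V W] /= [Vx Wy] VW]; exists (W, V) => //= -[y' x'] /= [Wy' Vx'].
  exact: (VW (x', y')).
apply: filterS => z Cz [y yr]; apply: Cz.
by rewrite /= in_itv /= -ler_norml.
Qed.

Lemma projective_class_Fsigma (R : realType) : projective_class R (@Fsigma).
Proof.
split.
- move=> X Y f _ cf [F cF ->]; rewrite preimage_bigcup.
  by exists (fun n => f @^-1` F n) => // n; move/continuous_closedP : cf; apply.
- move=> X _ _ [F cF ->] [F' cF' ->].
  rewrite (_ : _ `&` _ =
      [set x | exists ij : nat * nat, F ij.1 x /\ F' ij.2 x]).
    by apply: Fsigma_ex => -[i j]; exact: (closedI (cF i) (cF' j)).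
  apply/seteqP; split=> x /=.
    by move=> [[i _ Fi] [j _ Fj]]; exists (i, j).
  by move=> [[i j] /= [Fi Fj]]; split; [exists i|exists j].
- move=> X f cf.
  rewrite (_ : [set x | _] = [set x | exists n : nat, n.+1%:R^-1 <= f x]).
    apply: Fsigma_ex => n; move/continuous_closedP : cf => cf.
    exact: (cf _ (@closed_ge R n.+1%:R^-1)).
  apply/seteqP; split=> x /=; last by move=> [n]; exact/lt_le_trans.
  move=> fx; have [n] := ltr_add_invr fx; rewrite add0r => /ltW nf.
  by exists n.
- move=> X _ [F cF ->].
  rewrite (_ : _ @` _ = [set x | exists ij : nat * nat,
      exists2 y, `|y| <= ij.2%:R :> R & F ij.1 (x, y)]).
    by apply: Fsigma_ex => -[i j]; exact: closed_proj_bounded.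
  apply/seteqP; split=> x /=.
    move=> [[x' y] [i _ Fi] <-]; exists (i, (Num.truncn `|y|).+1), y => //=.
    by rewrite ltW// truncnS_gt.
  by move=> [[i j] [y _ Fi]]; exists (x, y) => //; exists i.
Qed.

End Fsigma.

Section graphs.
Context {R : realType} (h phi : R -> R).
Let Gh : set (R * R) := graph_on setT h.
Let Gphi : set (R * R) := graph_on [set t : R | 0 < t] phi.

Definition exceeds (c : R) (n : nat) (x : R) : Prop :=
  exists2 t, n%:R < t & c < h (t + x * phi t) - h t.

(** The values phi t, h (t + x phi t) and h t become quantified variables u, v
    and w, constrained to lie on the graphs. *)
Lemma projective_class_exceeds G (c : R) n : projective_class R G ->
  G _ Gh -> G _ Gphi -> G (R * \bar R)%type [set p | exceeds c n p.1].
Proof.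
move=> pG GGh GGphi.
pose Z : topologicalType := ((((R * \bar R) * R) * R) * R * R)%type.
pose x (z : Z) : R := z.1.1.1.1.1.
pose t (z : Z) : R := z.1.1.1.2.
pose u (z : Z) : R := z.1.1.2.
pose v (z : Z) : R := z.1.2.
pose w (z : Z) : R := z.2.
have c1 (X Y : topologicalType) (f : Z -> X * Y) :
    continuous f -> continuous (fun z => (f z).1).
  by move=> cf z; apply: cvg_comp (cf z) _; exact: fst_continuous.
have c2 (X Y : topologicalType) (f : Z -> X * Y) :
    continuous f -> continuous (fun z => (f z).2).
  by move=> cf z; apply: cvg_comp (cf z) _; exact: snd_continuous.
have cid : continuous (fun z : Z => z) by move=> z; exact: cvg_id.
have cx : continuous x by do 5!apply: (c1 _ _).
have ct : continuous t by apply: (c2 _ _); do 3!apply: (c1 _ _).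
have cu : continuous u by apply: (c2 _ _); do 2!apply: (c1 _ _).
have cv : continuous v by apply: (c2 _ _); apply: (c1 _ _).
have cw : continuous w by apply: (c2 _ _).
pose B : set Z := [set z | Gphi (t z, u z)] `&`
  ([set z | Gh (t z + x z * u z, v z)] `&` ([set z | Gh (t z, w z)] `&`
  ([set z | 0 < v z - w z - c] `&` [set z | 0 < t z - n%:R]))).
have GB : G _ B.
  apply: (pj_setI pG).
    apply: (pj_preimage pG (f := fun z => (t z, u z))) GGphi => z.
    exact: cvg_pair (ct z) (cu z).
  apply: (pj_setI pG).
    apply: (pj_preimage pG (f := fun z => (t z + x z * u z, v z))) GGh => z.
    exact: cvg_pair (cvgD (ct z) (cvgM (cx z) (cu z))) (cv z).
  apply: (pj_setI pG).
    apply: (pj_preimage pG (f := fun z => (t z, w z))) GGh => z.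
    exact: cvg_pair (ct z) (cw z).
  apply: (pj_setI pG); apply: (pj_pos pG) => z.
    by apply: cvgB; [exact: cvgB (cv z) (cw z)|exact: cvg_cst].
  by apply: cvgB (ct z) _; exact: cvg_cst.
rewrite (_ : [set p | _] = fst @` (fst @` (fst @` (fst @` B)))).
  by do 4!apply: (pj_proj pG).
apply/seteqP; split=> [p [s ns cs]|_ [_ [_ [_ [z Bz <-] <-] <-] <-]].
  exists (p, s) => //; exists (p, s, phi s) => //.
  exists (p, s, phi s, h (s + p.1 * phi s)) => //.
  exists (p, s, phi s, h (s + p.1 * phi s), h s) => //; do !split => //=.
  - exact: le_lt_trans ns.
  - by rewrite subr_gt0.
  - by rewrite subr_gt0.
move: Bz; rewrite /B /Gh /Gphi /graph_on /= => -[[t0 ut]].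
move=> [[_ vt] [[_ wt] []]]; rewrite !subr_gt0 => cvw nt.
by exists (t z) => //; rewrite -ut -vt -wt.
Qed.

(** * The upper limit and its rational thresholds *)

Definition frequently_exceeds (c x : R) : Prop := forall n, exceeds c n x.

Lemma ereal_rat_between (a b : \bar R) :
  (a < b)%E -> exists q : rat, (a < (ratr q)%:E < b)%E.
Proof.
move: a b => [a| |] [b| |] //=.
- by rewrite lte_fin => /rat_between[q qab]; exists q; rewrite !lte_fin.
- move=> _; have [q /andP[aq _]] : exists q : rat, a < ratr q < a + 1.
    by apply: rat_between; lra.
  by exists q; rewrite lte_fin aq ltry.
- move=> _; have [q /andP[_ qb]] : exists q : rat, b - 1 < ratr q < b.
    by apply: rat_between; lra.
  by exists q; rewrite lte_fin qb ltNyr.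
- by exists 0; rewrite ltry ltNyr.
Qed.

Lemma Hstar_frequently_exceeds (c x : R) :
  (c%:E < Hstar h phi x)%E -> frequently_exceeds c x.
Proof.
move=> cH n; have : (c%:E < ereal_sup ((fun t : R =>
    (h (t + x * phi t) - h t)%:E) @` [set t | (n%:R < t)%R]))%E.
  apply: (lt_le_trans cH); apply: ereal_inf_lbound.
  exists [set t | n%:R < t] => //; exists n%:R; split=> //; exact: num_real.
by move=> /ereal_sup_gt[_ [t nt <-]]; rewrite lte_fin => ct; exists t.
Qed.

Lemma frequently_exceeds_Hstar (c x : R) :
  frequently_exceeds c x -> (c%:E <= Hstar h phi x)%E.
Proof.
move=> fc; apply: le_ereal_inf_tmp => _ [V [M [_ MV]] <-].
have [t Mt ct] := fc (Num.truncn M).+1.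
apply: (@le_trans _ _ (h (t + x * phi t) - h t)%:E).
  by rewrite lee_fin ltW.
apply: ereal_sup_ubound; exists t => //; apply: MV.
by apply: lt_trans Mt; rewrite truncnS_gt.
Qed.

(** In this definition and the next, thresholds are rational so that countable
    operations suffice; Hstar_geP and Hstar_gtP give the meaning. *)
Definition Hstar_ge : set (R * \bar R) :=
  [set p | forall q : rat,
    (p.2 <= (ratr q)%:E)%E \/ frequently_exceeds (ratr q) p.1].

Definition Hstar_gt : set (R * \bar R) :=
  [set p | exists q : rat,
    (p.2 < (ratr q)%:E)%E /\ frequently_exceeds (ratr q) p.1].

Lemma Hstar_geP p : Hstar_ge p <-> (p.2 <= Hstar h phi p.1)%E.
Proof.
split=> [geH|yH q].
  rewrite leNgt; apply/negP => /ereal_rat_between[q /andP[Hq qy]].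
  have [|/frequently_exceeds_Hstar] := geH q.
    by rewrite leNgt qy.
  by rewrite leNgt Hq.
have [?|qy] := leP p.2 (ratr q)%:E; [by left|right].
by apply: Hstar_frequently_exceeds; exact: lt_le_trans yH.
Qed.

Lemma Hstar_gtP p : Hstar_gt p <-> (p.2 < Hstar h phi p.1)%E.
Proof.
split=> [[q [yq /frequently_exceeds_Hstar]]|]; first exact: lt_le_trans.
move=> /ereal_rat_between[q /andP[yq qH]]; exists q; split=> //.
exact: Hstar_frequently_exceeds.
Qed.

Lemma graph_Hstar : graph_on setT (Hstar h phi) = Hstar_ge `\` Hstar_gt.
Proof.
apply/seteqP; split=> p.
  move=> [_ pH]; split; first by apply/Hstar_geP; rewrite pH.
  by move/Hstar_gtP; rewrite pH ltxx.
move=> [/Hstar_geP le_pH /Hstar_gtP/negP]; rewrite -leNgt => ge_pH.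
by split=> //; apply/eqP; rewrite eq_le le_pH.
Qed.

Section Hstar_class.
Variable G : pointclass.
Hypothesis gG : sigma_pointclass G.
Hypothesis G_exceeds :
  forall c n, @G (R * \bar R)%type [set p | exceeds c n p.1].

Lemma Hstar_ge_class : @G _ Hstar_ge.
Proof.
apply: (pc_all gG) => q; apply: (pc_setU gG); last exact: (pc_all gG).
apply: (pc_borel gG); apply: closed_borel.
have /continuous_closedP cs := @snd_continuous R (\bar R).
exact: (cs _ (@closed_ereal_ge_ereal R (ratr q)%:E)).
Qed.

Lemma Hstar_gt_class : @G _ Hstar_gt.
Proof.
apply: (pc_ex gG) => q; apply: (pc_setI gG); last exact: (pc_all gG).
apply: (pc_borel gG); apply: open_borel.
have /continuousP cs := @snd_continuous R (\bar R).
exact: (cs _ (@open_ereal_lt_ereal R (ratr q)%:E)).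
Qed.

End Hstar_class.

End graphs.

(** * Suslin schemes *)

(** Continuity of D in both codes, uniformly in them: the coordinates that
    matter are fixed in advance. *)
Definition finitely_determined {T : Type}
    (D : (nat -> nat) -> (nat -> nat) -> T) :=
  exists s : seq nat, forall a a' b b', {in s, a =1 a'} -> {in s, b =1 b'} ->
    D a b = D a' b'.

(** E is obtained from sets in M and conditions on the code b by the Suslin
    operation, a being the code quantified by the operation.  The code b remains
    free, so that it can later represent the real coordinate along which one
    projects. *)
Definition suslin {X : Type} (M : set (set X)) (E : set (X * (nat -> nat))) :=
  exists D : nat -> (nat -> nat) -> (nat -> nat) -> set X,
  [/\ forall n a b, M (D n a b), forall n, finitely_determined (D n) &
      forall x b, E (x, b) <-> exists a, forall n, D n a b x].

Section suslin_closure.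
Context {X : Type} {M : set (set X)}.
Hypothesis sM : sigma_algebra setT M.

Let MT : M setT := sigma_cst sM True.

Lemma suslin_const (E : set X) : M E -> suslin M [set p | E p.1].
Proof.
move=> ME; exists (fun _ _ _ => E); split=> //.
  by move=> n; exists [::].
by move=> x b; split=> [Ex|[a /(_ 0)]] //; exists id.
Qed.

Lemma suslin_coordinate (i : nat) (P : nat -> Prop) :
  suslin M [set p | P (p.2 i)].
Proof.
exists (fun _ _ b => [set x | P (b i)]); split.
- by move=> n a b; exact: sigma_cst.
- by move=> n; exists [:: i] => a a' b b' _ /(_ i) ->; rewrite ?mem_head.
- by move=> x b; split=> [Pi|[a /(_ 0)]] //; exists id.
Qed.

(** One sequence a codes the sequences a (pickle (k, _)), one for each E k. *)
Lemma suslin_bigcap (E : nat -> set (X * (nat -> nat))) :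
  (forall k, suslin M (E k)) -> suslin M (\bigcap_k E k).
Proof.
move=> /(_ _)/cid-/all_sig[D DP].
pose D' n a b : set X := if unpickle n is Some kj
  then D kj.1 kj.2 (fun i => a (pickle (kj.1, i))) b else setT.
exists D'; split.
- by move=> n a b; rewrite /D'; case: unpickle => // -[k j]; case: (DP k).
- move=> n; rewrite /D'; case: unpickle => [[k j]|]; last by exists [::].
  have [_ /(_ j)[s sP] _] := DP k.
  exists (s ++ [seq pickle (k, i) | i <- s]) => a a' b b' eqa eqb.
  apply: sP => i si; last by apply: eqb; rewrite mem_cat si.
  by apply: eqa; rewrite mem_cat orbC (map_f (fun i => pickle (k, i)) si).
- move=> x b; split=> [Ex|[a Da] k _].
    have /(_ _)/cid-/all_sig[a aP] k : exists a, forall n, D k n a b x.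
      by have [_ _ DE] := DP k; exact/DE/Ex.
    exists (fun m => if unpickle m is Some (k, i) then a k i else 0%N) => n.
    rewrite /D'; case: unpickle => // -[k j] /=.
    rewrite (_ : (fun i => _) = a k); first exact: aP.
    by apply/funext => i; rewrite pickleK.
  have [_ _ DE] := DP k; apply/DE; exists (fun i => a (pickle (k, i))) => j.
  by have := Da (pickle (k, j)); rewrite /D' pickleK.
Qed.

(** The first term of a selects the member E k of the union, and the rest is a
    code for E k.  Each condition belongs to a fixed E k and is void unless
    a 0 = k; with the conditions of E (a 0) taken directly, the terms of a that
    matter would depend on a 0. *)
Lemma suslin_bigcup (E : nat -> set (X * (nat -> nat))) :
  (forall k, suslin M (E k)) -> suslin M (\bigcup_k E k).
Proof.
move=> /(_ _)/cid-/all_sig[D DP].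
pose D' n a b : set X := if unpickle n is Some kj
  then (if a 0 == kj.1 then D kj.1 kj.2 (fun i => a i.+1) b else setT)
  else setT.
exists D'; split.
- move=> n a b; rewrite /D'; case: unpickle => // -[k j].
  by case: ifP => // _; case: (DP k).
- move=> n; rewrite /D'; case: unpickle => [[k j]|]; last by exists [::].
  have [_ /(_ j)[s sP] _] := DP k.
  exists (0%N :: s ++ [seq i.+1 | i <- s]) => a a' b b' eqa eqb.
  rewrite eqa ?mem_head//=; case: ifP => // _; apply: sP => i si.
    by apply: eqa; rewrite inE mem_cat orbC (map_f S si) orbT.
  by apply: eqb; rewrite inE mem_cat si orbT.
- move=> x b; split=> [[k _]|[a Da]].
    have [_ _ DE] := DP k; move=> /DE[a Da].
    exists (fun i => if i is j.+1 then a j else k) => n.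
    by rewrite /D'; case: unpickle => // -[k' j] /=; case: eqP => // <-.
  exists (a 0%N) => //; have [_ _ DE] := DP (a 0%N).
  apply/DE; exists (fun i => a i.+1) => j.
  by have := Da (pickle (a 0%N, j)); rewrite /D' pickleK /= eqxx.
Qed.

(** Suslin sets are not closed under complement; those with a Suslin complement
    form a sigma-algebra, which suffices to reach the Borel sets. *)
Definition bisuslin (E : set (X * (nat -> nat))) :=
  suslin M E /\ suslin M (~` E).

Lemma sigma_algebra_bisuslin : sigma_algebra setT bisuslin.
Proof.
split.
- split; first exact: (suslin_const (sigma_cst sM False)).
  by rewrite setC0; exact: (suslin_const MT).
- by move=> E [sE snE]; rewrite setTD; split=> //; rewrite setCK.
- move=> E bE; split; first by apply: suslin_bigcup => k; case: (bE k).
  by rewrite setC_bigcup; apply: suslin_bigcap => k; case: (bE k).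
Qed.

End suslin_closure.

(** Reals are replaced by codes b via the cut of b, a surjection on R for which
    Borel conditions become bisuslin; the code b is then merged with the code a
    of the scheme, on the odd and the even terms of one sequence. *)
Lemma analytic_suslin (R : realType) (X : topologicalType) (A : set X) :
  analytic R A -> exists D : nat -> (nat -> nat) -> set X,
  [/\ forall n a, borel (D n a),
      forall n, exists s : seq nat,
        forall a a', {in s, a =1 a'} -> D n a = D n a' &
      A = [set x | exists a, forall n, D n a x]].
Proof.
move=> [B bB ->]; have sX := sigma_algebra_borel X.
pose y (b : nat -> nat) : R := cut_sup [set q : rat | b (pickle q) != 0%N].
have : @bisuslin X borel ((fun p : X * (nat -> nat) => (p.1, y p.2)) @^-1` B).
  apply: borel_pair_sigma bB; first exact: sigma_algebra_bisuslin.
  - move=> U /open_borel bU; split; first exact: suslin_const.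
    exact: (suslin_const (sigmaN sX bU)).
  - apply: (cut_sup_sigma R (sigma_algebra_bisuslin sX)
      (S := fun p => [set q : rat | p.2 (pickle q) != 0%N])) => q.
    split; first exact: (suslin_coordinate sX (pickle q) (fun m => m != 0%N)).
    exact: (suslin_coordinate sX (pickle q) (fun m => ~ (m != 0%N))).
move=> [[D [bD fD DB]] _].
exists (fun n c => D n (fun i => c i.*2) (fun i => c i.*2.+1)); split.
- by move=> n c; exact: bD.
- move=> n; have [s sP] := fD n.
  exists ([seq i.*2 | i <- s] ++ [seq i.*2.+1 | i <- s]) => c c' eqc.
  apply: sP => i si; apply: eqc; rewrite mem_cat.
    by rewrite (map_f double si).
  by rewrite (map_f (fun i => i.*2.+1) si) orbT.
- apply/seteqP; split=> [_ [[x z] /= Bxz <-]|x /= [c Dc]].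
    pose b (m : nat) : nat :=
      if unpickle m is Some q then nat_of_bool (ratr (q : rat) < z)%R else 0%N.
    have yb : y b = z.
      rewrite -[RHS]cut_sup_lt /y; congr cut_sup; apply/seteqP.
      by split=> q /=; rewrite /b pickleK eqb0 negbK.
    have /DB[a Da] : ((fun p => (p.1, y p.2)) @^-1` B) (x, b) by rewrite /= yb.
    exists (fun i => if odd i then b i./2 else a i./2) => n.
    rewrite (_ : (fun i => _) = a); last first.
      by apply/funext => i; rewrite odd_double doubleK.
    rewrite (_ : (fun i => _) = b) //.
    by apply/funext => i; rewrite /= odd_double /= uphalf_double.
  exists (x, y (fun i => c i.*2.+1)) => //.
  by apply/DB; exists (fun i => c i.*2).
Qed.

(** * Koenig's lemma *)

(** Compactness of the product of the finite sets [0, N i]: a is the limit of c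
    along a nonprincipal ultrafilter, which selects one of the finitely many
    values of each coordinate. *)
Lemma bounded_sequences_cluster (N : nat -> nat) (c : nat -> nat -> nat) :
  (forall k i, (c k i <= N i)%N) ->
  exists a, (forall i, (a i <= N i)%N) /\
    forall m (s : seq nat), exists2 k, (m <= k)%N & {in s, c k =1 a}.
Proof.
move=> cN; have [F [UF sF]] := ultraFilterLemma (F := \oo) _.
have val i : exists v, F [set k | c k i = v].
  apply: contrapT => /forallNP nF.
  have avoid n : F [set k | forall v, (v <= n)%N -> c k i <> v].
    elim: n => [|n IH].
      have [/nF //|] := in_ultra_setVsetC [set k | c k i = 0%N] UF.
      by apply: filterS => k ck v; rewrite leqn0 => /eqP ->.
    have [/nF //|ne] := in_ultra_setVsetC [set k | c k i = n.+1] UF.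
    apply: filterS (filterI IH ne) => k [ck1 ck2] v; rewrite leq_eqVlt ltnS.
    by move=> /orP[/eqP -> //|/ck1].
  by have [k /(_ (c k i) (cN k i))] := filter_ex (avoid (N i)).
pose a i := sval (cid (val i)).
have aP i : F [set k | c k i = a i] := svalP (cid (val i)).
exists a; split=> [i|m s].
  by have [k /= <-] := filter_ex (aP i); exact: cN.
have Fs : F [set k | {in s, c k =1 a}].
  elim: s => [|i s IH]; first by apply: filterS filterT.
  apply: filterS (filterI (aP i) IH) => k [ci cs] j; rewrite inE.
  by move=> /orP[/eqP ->|/cs].
have Fm : F [set k | (m <= k)%N] by apply: sF; exact: nbhs_infty_ge.
by have [k [mk ck]] := filter_ex (filterI Fm Fs); exists k.
Qed.

(** * Measurability of Suslin sets *)

Section outer_content.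
Context d (T : measurableType d) (R : realType).
Variable mu : {finite_measure set T -> \bar R}.
Local Open Scope ereal_scope.

Definition outer (A : set T) : \bar R :=
  ereal_inf [set mu H | H in [set H | measurable H /\ A `<=` H]].

Lemma outer_le A H : measurable H -> A `<=` H -> outer A <= mu H.
Proof. by move=> mH AH; apply: ereal_inf_lbound; exists H. Qed.

Lemma le_outer A B : A `<=` B -> outer A <= outer B.
Proof.
move=> AB; apply: ereal_inf_le_tmp => _ [H [mH BH] <-].
by exists H => //; split=> //; exact: subset_trans BH.
Qed.

Lemma outer_fin_num A : outer A \is a fin_num.
Proof.
rewrite ge0_fin_numE.
  by apply: (le_lt_trans (@outer_le A setT _ _)) => //; exact: fin_num_fun_lty.
by apply: le_ereal_inf_tmp => _ [H [mH _] <-].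
Qed.

Lemma outer_hull A : exists H, [/\ measurable H, A `<=` H & mu H = outer A].
Proof.
have inv0 (n : nat) : (0 < n.+1%:R^-1 :> R)%R by [].
have adh n : exists H, [/\ measurable H, A `<=` H &
    mu H < outer A + (n.+1%:R^-1)%:E].
  have [_ [H [mH AH] <-] muH] :=
    lb_ereal_inf_adherent (inv0 n) (outer_fin_num A).
  by exists H.
have /all_sig[H HP] n := cid (adh n).
have mH : measurable (\bigcap_n H n).
  by apply: bigcapT_measurable => n; case: (HP n).
have AH : A `<=` \bigcap_n H n by move=> x Ax n _; case: (HP n) => _ + _; exact.
exists (\bigcap_n H n); split=> //; apply/eqP; rewrite eq_le outer_le// andbT.
apply/lee_addgt0Pr => e e0; have [n] := ltr_add_invr e0.
rewrite add0r => ne; have [mHn _ /ltW muHn] := HP n.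
apply: (@le_trans _ _ (mu (H n))).
  by rewrite le_measure ?inE//; exact: bigcap_inf.
by apply: (le_trans muHn); rewrite leeD2l// lee_fin ltW.
Qed.

(** Outer measure is continuous from below on arbitrary sets, since increasing
    sets have increasing hulls of the same outer measure: intersect the hulls
    of all later sets. *)
Lemma outer_bigcup (A : nat -> set T) (a : \bar R) :
  {homo A : m n / (m <= n)%N >-> m `<=` n} ->
  a < outer (\bigcup_n A n) -> exists n, a < outer (A n).
Proof.
move=> ndA aA; apply: contrapT => /forallNP nA.
have le_a n : outer (A n) <= a by rewrite leNgt; exact/negP/nA.
have /all_sig[H HP] n := cid (outer_hull (A n)).
have mH n : measurable (H n) by case: (HP n).
pose K n := \bigcap_(i in [set i | (n <= i)%N]) H i.
have mK n : measurable (K n).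
  by apply: bigcap_measurable => //; exists n => /=.
have AK n : A n `<=` K n.
  by move=> x Ax i /= ni; case: (HP i) => _ + _; apply; exact: ndA Ax.
have muK n : mu (K n) <= a.
  apply: le_trans (le_a n); case: (HP n) => _ _ <-.
  by rewrite le_measure ?inE//; apply: bigcap_inf => /=.
have ndK : nondecreasing_seq K.
  move=> m n mn; apply/subsetPset => x Kx i /= ni.
  by apply: Kx => /=; exact: leq_trans ni.
have mcup : measurable (\bigcup_n K n) by exact: bigcupT_measurable.
have lim := nondecreasing_cvg_mu mK mcup ndK (mu := mu).
have : mu (\bigcup_n K n) <= a.
  rewrite -(cvg_lim _ lim)//; apply: lime_le.
    by apply/cvg_ex; eexists; exact: lim.
  by apply: nearW => n; exact: muK.
rewrite leNgt (lt_le_trans aA)//; apply: outer_le => //.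
by apply: subset_bigcup => n _; exact: AK.
Qed.

End outer_content.

Section suslin_measurable.
Context d (T : measurableType d) (R : realType).
Variable mu : {finite_measure set T -> \bar R}.
Variable D : nat -> (nat -> nat) -> set T.
Hypothesis mD : forall n a, measurable (D n a).
Hypothesis fD : forall n, exists s : seq nat,
  forall a a', {in s, a =1 a'} -> D n a = D n a'.
Let A : set T := [set x | exists a, forall n, D n a x].
Local Open Scope ereal_scope.

(** The terms of the codes are bounded one at a time, because A is an increasing
    union over the bound on the next term. *)
Let bounded_part (s : seq nat) : set T := [set x | exists2 a : nat -> nat,
  (forall i, (i < size s)%N -> (a i <= nth 0 s i)%N) & forall n, D n a x].

Let outer_bounded_part (s : seq nat) (c : \bar R) :
  c < outer mu (bounded_part s) ->
  exists m, c < outer mu (bounded_part (rcons s m)).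
Proof.
move=> cs; apply: outer_bigcup.
  move=> m n mn x [a as_ Da]; exists a => // i.
  rewrite size_rcons => i_s; have := as_ i; rewrite size_rcons => /(_ i_s).
  by rewrite !nth_rcons; case: ltngtP => // _ /leq_trans; exact.
rewrite (_ : \bigcup_n _ = bounded_part s)//.
apply/seteqP; split=> [x [m _ [a as_ Da]]|x [a as_ Da]].
  exists a => // i si; have := as_ i; rewrite size_rcons nth_rcons si; apply.
  exact: ltnW.
exists (a (size s)) => //; exists a => // i.
rewrite size_rcons nth_rcons ltnS leq_eqVlt => /orP[/eqP ->|si].
  by rewrite ltnn eqxx.
by rewrite si; exact: as_.
Qed.

Let bounded_codes (c : \bar R) : c < outer mu A ->
  exists N : nat -> nat, forall k, c < outer mu
    [set x | exists2 a, (forall i, (i < k)%N -> (a i <= N i)%N) &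
       forall n, D n a x].
Proof.
move=> cA.
have /all_sig[g gP] (s : seq nat) : {m | c < outer mu (bounded_part s) ->
    c < outer mu (bounded_part (rcons s m))}.
  apply: cid; have [cs|ncs] := pselect (c < outer mu (bounded_part s)).
    by have [m ?] := outer_bounded_part cs; exists m.
  by exists 0%N => /ncs.
pose s_ k := iter k (fun s => rcons s (g s)) [::].
have size_s k : size (s_ k) = k by elim: k => //= k IH; rewrite size_rcons IH.
have c_s k : c < outer mu (bounded_part (s_ k)).
  elim: k => [|k]; last exact: gP.
  apply: (lt_le_trans cA); apply: le_outer => x [a Da].
  by exists a.
have nth_s k i : (i < k)%N -> nth 0%N (s_ k) i = g (s_ i).
  elim: k => // k IH; rewrite ltnS leq_eqVlt /= nth_rcons size_s.
  by move=> /orP[/eqP ->|ik]; [rewrite ltnn eqxx|rewrite ik IH].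
exists (fun i => g (s_ i)) => k; apply: (lt_le_trans (c_s k)); apply: le_outer.
move=> x [a as_ Da]; exists a => // i ik.
by rewrite -(nth_s k)//; apply: as_; rewrite size_s.
Qed.

(** K k keeps the codes bounded by N and the first k + 1 conditions.  These
    involve finitely many terms of the code, so K k is measurable, and contains
    a bounded part of A of outer measure above c. *)
Lemma suslin_inner_approx (c : \bar R) : c < outer mu A ->
  exists K, [/\ measurable K, K `<=` A & c <= mu K].
Proof.
move=> /bounded_codes[N cN].
pose K k : set T := [set x | exists2 a : nat -> nat,
  (forall i, (a i <= N i)%N) & forall n, (n <= k)%N -> D n a x].
have /all_sig[b bP] n : {m | forall a a',
    (forall i, (i < m)%N -> a i = a' i) -> D n a = D n a'}.
  apply: cid; have [s sP] := fD n; exists (\max_(i <- s) i).+1 => a a' aa'.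
  by apply: sP => i si; apply: aa'; rewrite ltnS; exact: leq_bigmax_seq.
pose m k := \max_(n < k.+1) b n.
have le_m k n : (n <= k)%N -> (b n <= m k)%N.
  move=> nk; have nk' : (n < k.+1)%N by rewrite ltnS.
  exact: (leq_bigmax (F := fun i : 'I_k.+1 => b i) (Ordinal nk')).
have mK k : measurable (K k).
  have sT := @sigma_algebra_measurable d T.
  rewrite (_ : K k = [set x | exists s : seq nat,
      (forall i, (nth 0 s i <= N i)%N) /\
      forall n : 'I_k.+1, D n (nth 0%N s) x]).
    apply: (sigma_ex sT) => s; apply: (sigma_and sT); first exact: sigma_cst.
    by apply: (sigma_all sT) => n; exact: mD.
  apply/seteqP; split=> x /= [a]; last first.
    by move=> [aN Da]; exists (nth 0%N a) => // n; rewrite -ltnS => nk;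
      exact: (Da (Ordinal nk)).
  move=> aN Da; exists (mkseq a (m k)); split=> [i|n].
    have [im|mi] := ltnP i (m k); first by rewrite nth_mkseq.
    by rewrite nth_default// size_mkseq.
  have nk : (n <= k)%N by rewrite -ltnS.
  rewrite -(bP n a); first exact: Da.
  by move=> i ib; rewrite nth_mkseq// (leq_trans ib)// le_m.
have cK k : c <= mu (K k).
  apply: (le_trans (ltW (cN (m k)))); apply: outer_le => // x [a aN Da].
  exists (fun i => if (i < m k)%N then a i else 0%N) => [i|n nk].
    by case: ifPn => // /aN.
  rewrite -(bP n a)// => i ib.
  by rewrite (leq_trans ib)// le_m.
have mcap : measurable (\bigcap_k K k) by exact: bigcapT_measurable.
have niK : nonincreasing_seq K.
  move=> i j ij; apply/subsetPset => x [a aN Da]; exists a => // n ni.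
  by apply: Da; exact: leq_trans ij.
exists (\bigcap_k K k); split=> //.
  (* a cluster point of codes that fulfil more and more conditions *)
  move=> x Kx; have /(_ _)/cid2-/all_sig2[a aN Da] k := Kx k Logic.I.
  have [a' [_ a'P]] := bounded_sequences_cluster aN.
  exists a' => n; have [s sP] := fD n; have [k nk ka'] := a'P n s.
  by rewrite -(sP _ _ ka'); exact: Da.
have K0_fin : mu (K 0%N) < +oo by rewrite ltey_eq fin_num_measure.
have lim := nonincreasing_cvg_mu (mu := mu) K0_fin mK mcap niK.
rewrite -(cvg_lim _ lim)//; apply: lime_ge.
  by apply/cvg_ex; eexists; exact: lim.
by apply: nearW => k; exact: cK.
Qed.

(** Inner approximations whose measures tend to the outer measure of A exhaust
    the measurable hull of A up to a null set. *)
Lemma suslin_sandwich : exists K H, [/\ measurable K, measurable H, K `<=` A,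
  A `<=` H & mu (H `\` K) = 0].
Proof.
have [H [mH AH muH]] := outer_hull mu A.
have inv0 (n : nat) : (0 < n.+1%:R^-1 :> R)%R by [].
have fA := outer_fin_num mu A.
have /all_sig[K KP] n : {K | [/\ measurable K, K `<=` A &
    outer mu A - (n.+1%:R^-1)%:E <= mu K]}.
  by apply: cid; apply: suslin_inner_approx; rewrite lteBlDr// lteDl.
have mK : measurable (\bigcup_n K n).
  by apply: bigcupT_measurable => n; case: (KP n).
have KA : \bigcup_n K n `<=` A by move=> x [n _]; case: (KP n) => _ + _; exact.
exists (\bigcup_n K n), H; split=> //.
apply/eqP; rewrite -measure_le0; apply/lee_addgt0Pr => e e0; rewrite add0e.
have [n] := ltr_add_invr e0; rewrite add0r => ne; have [mKn KnA muKn] := KP n.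
apply: (@le_trans _ _ (mu (H `\` K n))).
  rewrite le_measure ?inE//; [exact: measurableD|exact: measurableD|].
  by apply: setDS; exact: bigcup_sup.
have -> : mu (H `\` K n) = mu H - mu (K n).
  rewrite measureD//; last by rewrite ltey_eq fin_num_measure.
  by rewrite setIidr//; exact: subset_trans AH.
rewrite muH leeBlDr; last exact: fin_num_measure.
apply: (@le_trans _ _ ((n.+1%:R^-1)%:E + mu (K n))); last first.
  by rewrite leeD2r// lee_fin ltW.
by rewrite addeC -leeBlDr.
Qed.

End suslin_measurable.

Section completion.
Context d (T : measurableType d) (R : realType).
Variable mu : {measure set T -> \bar R}.

(** This form of membership is symmetric under complements. *)
Lemma completed_sandwichP (A : set T) : completed_algebra_gen mu A <->
  exists K H, [/\ measurable K, measurable H, K `<=` A, A `<=` H &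
    mu (H `\` K) = 0%E].
Proof.
split=> [[K mK [N [H [mH H0 NH]] <-]]|[K [H [mK mH KA AH HK0]]]].
  exists K, (K `|` H); split=> //; first exact: measurableU.
    exact: setUS.
  apply/eqP; rewrite -measure_le0 -H0 le_measure ?inE//.
    by apply: measurableD => //; exact: measurableU.
  by move=> x [[|//]].
exists K => //; exists (A `\` K); last by rewrite setDUK.
by exists (H `\` K); split=> //; [exact: measurableD|exact: setSD].
Qed.

Lemma sigma_algebra_completed : sigma_algebra setT (completed_algebra_gen mu).
Proof.
split.
- apply/completed_sandwichP; exists set0, set0; split=> //.
  by rewrite setD0 measure0.
- move=> A /completed_sandwichP[K [H [mK mH KA AH HK0]]].
  apply/completed_sandwichP; rewrite setTD; exists (~` H), (~` K).
  split; [exact: measurableC|exact: measurableC|exact: subsetC|exact: subsetC|].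
  by rewrite setDE setCK setIC -setDE.
- move=> A /(_ _)/completed_sandwichP/cid-/all_sig[K /(_ _)/cid-/all_sig[H KH]].
  apply/completed_sandwichP; exists (\bigcup_n K n), (\bigcup_n H n); split.
  + by apply: bigcupT_measurable => n; case: (KH n).
  + by apply: bigcupT_measurable => n; case: (KH n).
  + by apply: subset_bigcup => n _; case: (KH n).
  + by apply: subset_bigcup => n _; case: (KH n).
  have mKs : measurable (\bigcup_n K n).
    by apply: bigcupT_measurable => n; case: (KH n).
  have mHs : measurable (\bigcup_n H n).
    by apply: bigcupT_measurable => n; case: (KH n).
  have [N [mN N0 HN]] : mu.-negligible (\bigcup_n (H n `\` K n)).
    apply: negligible_bigcup => n; have [mK mH _ _ HK0] := KH n.
    by exists (H n `\` K n); split=> //; exact: measurableD.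
  apply: (@subset_measure0 _ _ _ mu _ N) => //; first exact: measurableD.
  apply: subset_trans HN => x [[n _ Hx] nK]; exists n => //; split=> // Kx.
  by apply: nK; exists n.
Qed.

End completion.

(** The traces of mu on the sets of finite measure of an exhaustion reduce the
    sigma-finite case to the finite one. *)
Lemma suslin_completed d (T : measurableType d) (R : realType)
    (mu : {measure set T -> \bar R}) (D : nat -> (nat -> nat) -> set T) :
  sigma_finite setT mu -> (forall n a, measurable (D n a)) ->
  (forall n, exists s : seq nat,
    forall a a', {in s, a =1 a'} -> D n a = D n a') ->
  completed_algebra_gen mu [set x | exists a, forall n, D n a x].
Proof.
move=> /sigma_finiteP[F [FT _ F_fin]] mD fD; set A := [set x | _].
have -> : A = \bigcup_n (A `&` F n) by rewrite -setI_bigcupr -FT setIT.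
have [_ _ Mcup] := sigma_algebra_completed mu.
apply: Mcup => n; have [mF Foo] := F_fin n.
have [K [H [mK mH KA AH]]] := suslin_sandwich (mfrestr mF Foo) mD fD.
rewrite /mfrestr /mrestr => HK0.
apply/completed_sandwichP; exists (K `&` F n), (H `&` F n).
split; [exact: measurableI|exact: measurableI|exact: setSI|exact: setSI|].
rewrite -[RHS]HK0; congr (mu _); apply/seteqP; split=> x /=.
  by move=> [[Hx Fx] nKF]; split=> //; split=> // Kx; exact: nKF.
by move=> [[Hx nKx] Fx]; split=> // -[].
Qed.

(** * Lebesgue measurability of analytic sets *)
Section lebesgue.
Context {R : realType}.

Lemma analytic_preimage_completed d (T : measurableType d)
    (mu : {measure set T -> \bar R}) (X : topologicalType)
    (e : T -> X) (A : set X) :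
  sigma_finite setT mu -> (forall U, open U -> measurable (e @^-1` U)) ->
  analytic R A -> completed_algebra_gen mu (e @^-1` A).
Proof.
move=> smu oe /analytic_suslin[D [bD fD ->]].
apply: (suslin_completed (D := fun n a => e @^-1` D n a) smu) => [n a|n].
  exact: (borel_preimage_sigma (@sigma_algebra_measurable d T) oe (bD n a)).
by have [s sP] := fD n; exists s => a a' /sP ->.
Qed.

Lemma borel_measurable_plane (B : set (R * R)) :
  borel B -> measurable (B : set (measurableTypeR R * measurableTypeR R)).
Proof.
pose T := (measurableTypeR R * measurableTypeR R)%type.
move=> bB; have := @borel_pair_sigma R T measurable R fst snd
  (@sigma_algebra_measurable _ T) _ _ B bB.
rewrite (_ : _ @^-1` B = B); last by apply/seteqP; split=> -[].
apply.
  by move=> U oU; rewrite -[X in measurable X]setTI;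
    apply: measurable_fst => //; exact: open_measurable.
move=> q; rewrite -[X in measurable X]setTI.
apply: (measurable_snd measurableT [set y : measurableTypeR R | ratr q < y]).
exact: (open_measurable (@open_gt R (ratr q))).
Qed.

Lemma sigma_finite_plane :
  sigma_finite setT (@lebesgue_measure R \x @lebesgue_measure R)%E.
Proof.
have /sigma_finiteP[F [FT ndF F_fin]] := sigma_finiteT (@lebesgue_measure R).
exists (fun n => F n `*` F n) => [|n].
  apply/seteqP; split=> // -[x y] _.
  have [i _ Fx] : (\bigcup_i F i) x by rewrite -FT.
  have [j _ Fy] : (\bigcup_i F i) y by rewrite -FT.
  exists (maxn i j) => //; split => /=.
    by have /subsetPset := ndF _ _ (leq_maxl i j); exact.
  by have /subsetPset := ndF _ _ (leq_maxr i j); exact.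
have [mF F_lty] := F_fin n; split; first exact: measurableX.
by rewrite product_measure1E// lte_mul_pinfty// ge0_fin_numE.
Qed.

Lemma EFin_continuous : continuous (@EFin R).
Proof. by move=> r U. Qed.

Lemma analytic_diff_preimage_completed d (T : measurableType d)
    (mu : {measure set T -> \bar R}) (X : topologicalType) (e : T -> X)
    (A B : set X) :
  sigma_finite setT mu -> (forall U, open U -> measurable (e @^-1` U)) ->
  analytic R A -> analytic R B -> completed_algebra_gen mu (e @^-1` (A `\` B)).
Proof.
move=> smu oe aA aB; have sC := sigma_algebra_completed mu.
apply: (sigma_and sC); first exact: analytic_preimage_completed.
apply: (sigmaN sC); exact: (analytic_preimage_completed smu oe aB).
Qed.

Lemma lebesgue_measurable_ext_diff (A B : set (R * \bar R)) :
  analytic R A -> analytic R B -> lebesgue_measurable_ext (A `\` B).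
Proof.
move=> aA aB.
have line (y : \bar R) : completed_algebra_gen (@lebesgue_measure R)
    [set x | (A `\` B) (x, y)].
  have smu := sigma_finiteT (@lebesgue_measure R).
  pose e (x : measurableTypeR R) : R * \bar R := (x, y).
  apply: (analytic_diff_preimage_completed smu (e := e)) => // U oU.
  apply: open_measurable.
  have /continuousP ce : continuous (fun x : R => (x, y)).
    by move=> x; exact: cvg_pair cvg_id (cvg_cst _).
  exact: ce.
split; [|exact: line|exact: line].
pose e (p : measurableTypeR R * measurableTypeR R) : R * \bar R :=
  (p.1, p.2%:E).
have smu := sigma_finite_plane.
apply: (analytic_diff_preimage_completed smu (e := e)) => // U oU.
apply: borel_measurable_plane; apply: open_borel.
have /continuousP ce : continuous (fun p : R * R => (p.1, p.2%:E)).
  move=> p.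
  have cE := cvg_comp _ _ (@snd_continuous R R p) (@EFin_continuous p.2).
  exact: cvg_pair (@fst_continuous R R p) cE.
exact: ce.
Qed.

End lebesgue.

(** * The graph of H* *)

Theorem theorem11 (R : realType) (h phi : R -> R)
    (phi_gt0 : forall t : R, 0 < t -> 0 < phi t) :
  let Gh : set (R * R) := graph_on setT h in
  let Gphi : set (R * R) := graph_on [set t : R | 0 < t] phi in
  let GH : set (R * \bar R) := graph_on setT (Hstar h phi) in
  [/\ borel Gh -> borel Gphi ->
        [/\ exists A B : set (R * \bar R),
              [/\ analytic R A, analytic R B & GH = A `\` B],
            lebesgue_measurable_ext GH &
            Delta1 R 2 GH],
      Fsigma Gh -> Fsigma Gphi -> borel GH,
      analytic R Gh -> analytic R Gphi -> Pi1 R 2 GH &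
      coanalytic R Gh -> coanalytic R Gphi -> Pi1 R 3 GH].
Proof.
move=> Gh Gphi GH.
have GHE : GH = Hstar_ge h phi `\` Hstar_gt h phi by exact: graph_Hstar.
have ge_gt (G : pointclass) : sigma_pointclass G -> (projective_class R G) ->
    G _ Gh -> G _ Gphi -> G _ (Hstar_ge h phi) /\ G _ (Hstar_gt h phi).
  move=> gG pG GGh GGphi.
  have G_exceeds c n := projective_class_exceeds c n pG GGh GGphi.
  by split; [exact: Hstar_ge_class|exact: Hstar_gt_class].
have analytic_case : analytic R Gh -> analytic R Gphi ->
    analytic R (Hstar_ge h phi) /\ analytic R (Hstar_gt h phi).
  apply: (ge_gt (@analytic R)); first exact: sigma_pointclass_analytic.
  exact: (projective_class_proj R sigma_pointclass_borel).
have Pi12 : analytic R Gh -> analytic R Gphi -> Pi1 R 2 GH.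
  move=> aGh aGphi; have [age agt] := analytic_case aGh aGphi.
  rewrite /Pi1 GHE setCD setUC; apply: (pc_setU sigma_pointclass_Sigma12).
    exact: analytic_Sigma12.
  by apply: coanalytic_Sigma12; rewrite /coanalytic setCK.
split=> //.
- move=> bGh bGphi.
  have aGh : analytic R Gh := pc_borel sigma_pointclass_analytic bGh.
  have aGphi : analytic R Gphi := pc_borel sigma_pointclass_analytic bGphi.
  have [age agt] := analytic_case aGh aGphi; split.
  + by exists (Hstar_ge h phi), (Hstar_gt h phi).
  + by rewrite GHE; exact: lebesgue_measurable_ext_diff.
  + split; last exact: Pi12.
    rewrite GHE; apply: (pc_setI sigma_pointclass_Sigma12).
      exact: analytic_Sigma12.
    by apply: coanalytic_Sigma12; rewrite /coanalytic setCK.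
- move=> fGh fGphi.
  have b_exceeds c n : borel [set p : R * \bar R | exceeds h phi c n p.1].
    have [F cF ->] :=
      projective_class_exceeds c n (projective_class_Fsigma R) fGh fGphi.
    apply: (pc_cup sigma_pointclass_borel) => i; exact: closed_borel.
  rewrite GHE; apply: (pc_setI sigma_pointclass_borel).
    exact: (Hstar_ge_class sigma_pointclass_borel).
  apply: (sigmaN (sigma_algebra_borel _)).
  exact: (Hstar_gt_class sigma_pointclass_borel).
- move=> cGh cGphi.
  have [sge sgt] : Sigma1 R 2 (Hstar_ge h phi) /\ Sigma1 R 2 (Hstar_gt h phi).
    apply: (ge_gt (@Sigma1 R 2)); first exact: sigma_pointclass_Sigma12.
    + exact: (projective_class_proj R sigma_pointclass_coanalytic).
    + exact: coanalytic_Sigma12.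
    + exact: coanalytic_Sigma12.
  rewrite /Pi1 GHE setCD setUC; apply: (pc_setU sigma_pointclass_Sigma13).
    exact: Sigma12_Sigma13.
  by apply: Pi12_Sigma13; rewrite /Pi1 setCK.
Qed.
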